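(* Let $a,b\in\mathbb{R}^+$ with $a<b$. Then $$\left|L^{-1}(a,b)-A\left(\frac{4}{3a+b},\frac{4}{a+3b}\right)\right|\le\frac{(b-a)^2}{768}\left[\frac{a^3+b^3}{a^3b^3}+448\left(\frac{1}{(3a+b)^3}+\frac{1}{(a+3b)^3}\right)\right].$$
   Context: $\mathbb{R}^+$ is the set of positive reals. For $\alpha,\beta\in\mathbb{R}^+$, the arithmetic mean is $A(\alpha,\beta)=\frac{\alpha+\beta}{2}$, and for $\alpha\ne\beta$ the logarithmic mean is $L(\alpha,\beta)=\frac{\beta-\alpha}{\ln\beta-\ln\alpha}$. $L^{-1}(a,b)$ denotes $1/L(a,b)$. *)

(* Defs.v *)
From Stdlib Require Import Reals.
Local Open Scope R_scope.

Definition arith_mean (x y : R) : R := (x + y) / 2.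

(* Meaningful for positive x <> y only: at x = y the denominator vanishes, and
   the usual convention that the logarithmic mean of x and x is x is not built
   in. *)
Definition log_mean (x y : R) : R := (y - x) / (ln y - ln x).

(* Main.v *)
Require Import Defs.
From Stdlib Require Import Reals Lra.
From Coquelicot Require Import Coquelicot.
Local Open Scope R_scope.

(** Write [f x = / x].  The reciprocal of the logarithmic mean is the average of
    [f] over [[a, b]], and the arithmetic mean in the statement is the midpoint
    rule for that average, applied to the two halves of [[a, b]]: the midpoints
    are [(3a+b)/4] and [(a+3b)/4].  The theorem is thus an error estimate for the
    composite midpoint rule.

    On an interval [[c-d, c+d]] the error of the midpoint rule is
    the integral over [0 <= t <= d] of
    [(d-t)^2/2 * (f''(c+t) + f''(c-t))].  It is nonnegative since [f] is convex.
    As [f''(x) = 2/x^3] is convex too, it lies below its chords on [[c-d, c]] and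
    [[c, c+d]], which bounds the error by
    [d^3/12 * (6/c^3 + 1/(c+d)^3 + 1/(c-d)^3)]
    ([midpoint_le_ln_diff] and [ln_diff_le_midpoint]).  For this particular [f]
    both bounds are proved by scaling to [c = 1] and differentiating in [d]:
    they are equalities at [d = 0], and the difference of the two sides has a
    nonnegative rational derivative.

    Adding the estimates of the two halves, with [d = (b-a)/4], gives weight [6]
    at each midpoint, [1] at [a] and [b], and [2] at the common endpoint
    [(a+b)/2].  Since [(a+b)/2] is also the average of the two midpoints,
    convexity of [1/x^3] distributes that last weight equally over them, and the
    weights become [1, 7, 7, 1]; the factor [448 = 7 * 4^3] is the weight [7]
    after the denominators [4] of the midpoints are cleared. *)

Lemma nonneg_of_derive_nonneg (f df : R -> R) (u : R) :
  0 <= u -> f 0 = 0 ->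
  (forall t, 0 <= t <= u -> is_derive f t (df t)) ->
  (forall t, 0 <= t <= u -> 0 <= df t) ->
  0 <= f u.
Proof.
intros hu f0 hd hpos.
destruct (MVT_gen f 0 u df) as [t [ht eq]].
- intros t; rewrite Rmin_left, Rmax_right by lra; intros ht.
  apply hd; lra.
- intros t; rewrite Rmin_left, Rmax_right by lra; intros ht.
  apply derivable_continuous_pt.
  exists (df t); apply is_derive_Reals, hd; lra.
- rewrite Rmin_left, Rmax_right in ht by lra.
  pose proof (Rmult_le_pos (df t) (u - 0) (hpos t ht) ltac:(lra)).
  lra.
Qed.

Lemma ln_diff_unit_lower (u : R) :
  0 <= u < 1 -> 2 * u <= ln (1 + u) - ln (1 - u).
Proof.
intros hu.
apply Rminus_le_0.
apply (nonneg_of_derive_nonneg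
         (fun t => ln (1 + t) - ln (1 - t) - 2 * t)
         (fun t => 2 * t ^ 2 / (1 - t ^ 2))).
- lra.
- cbv beta; replace (1 - 0) with 1 by ring; replace (1 + 0) with 1 by ring; ring.
- intros t ht; auto_derive; [lra | field; nra].
- intros t ht; apply Rmult_le_pos; [nra |].
  left; apply Rinv_0_lt_compat; nra.
Qed.

(** In the derivative of the difference of the two sides the terms of order
    [u^2] cancel, because the weights [6, 1, 1] add up to [8], the value for
    which the bound has the exact leading term [2 u^3 / 3]. *)
Lemma ln_diff_unit_upper (u : R) :
  0 <= u < 1 ->
  ln (1 + u) - ln (1 - u)
  <= 2 * u + u ^ 3 / 12 * (6 + / (1 + u) ^ 3 + / (1 - u) ^ 3).
Proof.
intros hu.
apply Rminus_le_0.
apply (nonneg_of_derive_nonneg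
         (fun t => 2 * t + t ^ 3 / 12 * (6 + / (1 + t) ^ 3 + / (1 - t) ^ 3)
                   - (ln (1 + t) - ln (1 - t)))
         (fun t => t ^ 4 * (6 + 7 * t ^ 2 - 8 * t ^ 4 + 3 * t ^ 6)
                   / (2 * (1 - t ^ 2) ^ 4))).
- lra.
- cbv beta; replace (1 - 0) with 1 by ring; replace (1 + 0) with 1 by ring; field.
- intros t ht; auto_derive.
  + repeat split; try lra; apply Rgt_not_eq.
    * assert (0 < (1 + t) ^ 3) by (apply pow_lt; lra); simpl in *; lra.
    * assert (0 < (1 - t) ^ 3) by (apply pow_lt; lra); simpl in *; lra.
  + field; repeat split; nra.
- intros t ht.
  assert (hs : 0 <= t ^ 2 < 1) by nra.
  (* With [s = t^2], the term [8 s^2] is at most [7 s + 6] because [s < 1]. *)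
  apply Rmult_le_pos.
  + apply Rmult_le_pos; [apply pow_le; lra |].
    replace (t ^ 4) with ((t ^ 2) ^ 2) by ring.
    replace (t ^ 6) with ((t ^ 2) ^ 3) by ring.
    assert (0 <= (t ^ 2) ^ 3) by (apply pow_le; lra).
    nra.
  + left; apply Rinv_0_lt_compat.
    apply Rmult_lt_0_compat; [lra | apply pow_lt; lra].
Qed.

Lemma ratio_unit_interval (c d : R) : 0 <= d < c -> 0 <= d / c < 1.
Proof.
intros hd; split.
- apply Rdiv_le_0_compat; lra.
- apply Rlt_div_l; lra.
Qed.

Lemma ln_diff_scale (c d : R) :
  0 <= d < c ->
  ln (c + d) - ln (c - d) = ln (1 + d / c) - ln (1 - d / c).
Proof.
intros hd; pose proof (ratio_unit_interval c d hd).
replace (c + d) with (c * (1 + d / c)) by (field; lra).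
replace (c - d) with (c * (1 - d / c)) by (field; lra).
rewrite !ln_mult by lra; ring.
Qed.

(** The midpoint rule underestimates the integral of the convex function
    [1/x] over [[c-d, c+d]]. *)
Lemma midpoint_le_ln_diff (c d : R) :
  0 <= d < c -> 2 * d / c <= ln (c + d) - ln (c - d).
Proof.
intros hd; rewrite ln_diff_scale by assumption.
replace (2 * d / c) with (2 * (d / c)) by (field; lra).
apply ln_diff_unit_lower, ratio_unit_interval; assumption.
Qed.

(** The correction is the integral of the kernel [(d-t)^2/2] against the chords
    of the second derivative [2/x^3] on the two halves of the interval. *)
Lemma ln_diff_le_midpoint (c d : R) :
  0 <= d < c ->
  ln (c + d) - ln (c - d)
  <= 2 * d / c + d ^ 3 / 12 * (6 / c ^ 3 + / (c + d) ^ 3 + / (c - d) ^ 3).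
Proof.
intros hd; rewrite ln_diff_scale by assumption.
eapply Rle_trans.
- apply ln_diff_unit_upper, ratio_unit_interval; assumption.
- right; field; lra.
Qed.

(** Midpoint convexity of [1/x^3]: with [p = /x] and [q = /y], the harmonic mean
    of [x] and [y] is at most their arithmetic mean, so the left-hand side is at
    most [2 * ((p+q)/2)^3], and the rest is convexity of the cube. *)
Lemma inv_cube_midpoint (x y : R) :
  0 < x -> 0 < y -> 2 * / ((x + y) / 2) ^ 3 <= / x ^ 3 + / y ^ 3.
Proof.
intros hx hy.
assert (hm : / ((x + y) / 2) <= (/ x + / y) / 2).
{ apply Rminus_le_0.
  replace ((/ x + / y) / 2 - / ((x + y) / 2))
    with ((x - y) ^ 2 / (2 * x * y * (x + y))) by (field; lra).
  apply Rdiv_le_0_compat; [apply pow2_ge_0 |].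
  assert (0 < x * y) by (apply Rmult_lt_0_compat; lra).
  replace (2 * x * y * (x + y)) with (2 * (x * y) * (x + y)) by ring.
  apply Rmult_lt_0_compat; lra. }
rewrite <- !pow_inv.
assert (hp : 0 < / x) by (apply Rinv_0_lt_compat; lra).
assert (hq : 0 < / y) by (apply Rinv_0_lt_compat; lra).
assert (hz : 0 < / ((x + y) / 2)) by (apply Rinv_0_lt_compat; lra).
assert (hcube := pow_incr _ _ 3 (conj (Rlt_le _ _ hz) hm)).
assert (0 <= (/ x + / y) * (/ x - / y) ^ 2)
  by (apply Rmult_le_pos; [lra | apply pow2_ge_0]).
nra.
Qed.

Theorem proposition1 (a b : R) (ha : 0 < a) (hb : 0 < b) (hab : a < b) :
  Rabs (/ log_mean a b - arith_mean (4 / (3 * a + b)) (4 / (a + 3 * b)))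
  <= (b - a) ^ 2 / 768 *
     ((a ^ 3 + b ^ 3) / (a ^ 3 * b ^ 3)
      + 448 * (1 / (3 * a + b) ^ 3 + 1 / (a + 3 * b) ^ 3)).
Proof.
assert (hln : ln a < ln b) by (apply ln_increasing; lra).
set (x := (3 * a + b) / 4); set (y := (a + 3 * b) / 4).
set (m := (a + b) / 2); set (d := (b - a) / 4).
assert (hx : 0 <= d < x) by (unfold d, x; lra).
assert (hy : 0 <= d < y) by (unfold d, y; lra).
assert (lx := midpoint_le_ln_diff x d hx).
assert (ux := ln_diff_le_midpoint x d hx).
assert (ly := midpoint_le_ln_diff y d hy).
assert (uy := ln_diff_le_midpoint y d hy).
replace (x + d) with m in lx, ux by (unfold x, d, m; field).
replace (x - d) with a in lx, ux by (unfold x, d; field).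
replace (y + d) with b in ly, uy by (unfold y, d; field).
replace (y - d) with m in ly, uy by (unfold y, d, m; field).
assert (hconv := inv_cube_midpoint x y ltac:(lra) ltac:(lra)).
replace ((x + y) / 2) with m in hconv by (unfold x, y, m; field).
replace (/ log_mean a b - arith_mean (4 / (3 * a + b)) (4 / (a + 3 * b)))
  with ((ln b - ln a - 2 * d / x - 2 * d / y) / (b - a))
  by (unfold log_mean, arith_mean, x, y, d; field; lra).
rewrite Rabs_pos_eq by (apply Rdiv_le_0_compat; lra).
apply Rle_div_l; [lra |].
replace ((b - a) ^ 2 / 768 *
     ((a ^ 3 + b ^ 3) / (a ^ 3 * b ^ 3)
      + 448 * (1 / (3 * a + b) ^ 3 + 1 / (a + 3 * b) ^ 3)) * (b - a))
  with (d ^ 3 / 12 * (/ a ^ 3 + / b ^ 3 + 7 * / x ^ 3 + 7 * / y ^ 3))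
  by (unfold x, y, d; field; lra).
assert (hd3 : 0 <= d ^ 3 / 12)
  by (apply Rdiv_le_0_compat; [apply pow_le |]; lra).
assert (hmid := Rmult_le_compat_l _ _ _ hd3 hconv).
unfold Rdiv in *; lra.
Qed.
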